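(* For all integers $r, k \geq 2$, we have $s_r(K_{k+1}) \leq P_r(k)$.
   Context: All graphs are finite and simple. For graphs $G,H$ and an integer $r\ge 1$, write $G \rightarrow (H)_r$ if every colouring of the edges of $G$ with $r$ colours contains a monochromatic copy of $H$. A graph $G$ is $r$-Ramsey-minimal for $H$ if $G \rightarrow (H)_r$ but no proper subgraph $G'\subsetneq G$ satisfies $G' \rightarrow (H)_r$. Define $s_r(H) := \min \delta(G)$ over all graphs $G$ that are $r$-Ramsey-minimal for $H$, where $\delta$ denotes minimum degree. A colour pattern on a vertex set $V$ is a sequence $G_1,\dots,G_r$ of pairwise edge-disjoint graphs all having vertex set $V$; it is $H$-free if no $G_i$ contains $H$ as a subgraph. Given a colour pattern $G_1,\dots,G_r$ on $V$ and a colouring $c: V \to [r]$, a strongly monochromatic $K_k$ is a set of $k$ vertices all receiving the same colour $i$ under $c$ and forming a clique in $G_i$. $P_r(k)$ is the smallest integer $n$ such that there exists a $K_{k+1}$-free colour pattern $G_1,\dots,G_r$ on an $n$-element vertex set $V$ such that every colouring $V \to [r]$ yields a strongly monochromatic $K_k$. *)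

(* Defs.v *)
From mathcomp Require Import all_boot.
Set Implicit Arguments. Unset Strict Implicit. Unset Printing Implicit Defensive.

Definition simple_graph (V : finType) (E : rel V) : Prop :=
  (forall x y, E x y = E y x) /\ (forall x, E x x = false).

Definition complete_rel (m : nat) : rel 'I_m := fun a b => a != b.

(* An r-edge-colouring of a graph on V: a colour for each 2-set {x,y}
   (values on non-edges are irrelevant). *)
Definition edge_colouring (V : finType) (r : nat) := {set V} -> 'I_r.

Definition has_mono_copy (V : finType) (S : {set V}) (E : rel V) (r : nat)
    (c : edge_colouring V r) (W : finType) (EH : rel W) : Prop :=
  exists f : W -> V, injective f /\ (forall a, f a \in S) /\
    exists i : 'I_r, forall a b, EH a b ->
      E (f a) (f b) /\ c [set f a; f b] = i.

Definition arrows (V : finType) (S : {set V}) (E : rel V) (r : nat)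
    (W : finType) (EH : rel W) : Prop :=
  forall c : edge_colouring V r, has_mono_copy S E c EH.

Definition proper_subgraph (V : finType) (E : rel V) (S' : {set V}) (E' : rel V) : Prop :=
  (forall x y, E' x y = E' y x) /\
  (forall x y, E' x y -> [/\ E x y, x \in S' & y \in S']) /\
  (S' != setT \/ exists x y, E x y /\ ~~ E' x y).

Definition ramsey_minimal (V : finType) (E : rel V) (r : nat) (W : finType) (EH : rel W) : Prop :=
  arrows setT E r EH /\
  forall (S' : {set V}) (E' : rel V), proper_subgraph E S' E' -> ~ arrows S' E' r EH.

Definition degree (V : finType) (E : rel V) (x : V) : nat := #|[set y | E x y]|.

(* Minimum degree (for nonempty V; degrees are < #|V| so the default is harmless). *)
Definition min_degree (V : finType) (E : rel V) : nat :=
  \big[minn/#|V|]_(x : V) degree E x.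

Definition colour_pattern (V : finType) (r : nat) (G : 'I_r -> rel V) : Prop :=
  (forall i, simple_graph (G i)) /\
  (forall i j x y, i != j -> G i x y -> ~~ G j x y).

Definition has_clique (V : finType) (E : rel V) (m : nat) : Prop :=
  exists f : 'I_m -> V, injective f /\ forall a b, a != b -> E (f a) (f b).

Definition pattern_Kfree (V : finType) (r : nat) (G : 'I_r -> rel V) (m : nat) : Prop :=
  forall i, ~ has_clique (G i) m.

Definition strongly_mono_clique (V : finType) (r : nat) (G : 'I_r -> rel V)
    (c : V -> 'I_r) (k : nat) : Prop :=
  exists i : 'I_r, exists f : 'I_k -> V, injective f /\
    (forall a, c (f a) = i) /\ (forall a b, a != b -> G i (f a) (f b)).

Definition P_witness (r k n : nat) : Prop :=
  exists G : 'I_r -> rel 'I_n,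
    colour_pattern G /\ pattern_Kfree G k.+1 /\
    forall c : 'I_n -> 'I_r, strongly_mono_clique G c k.

(* Main.v *)
Require Import Defs.
From mathcomp Require Import all_boot.
From Stdlib Require Import Classical_Prop.
Set Implicit Arguments. Unset Strict Implicit. Unset Printing Implicit Defensive.

(* Burr, Erdos and Lovasz: if a graph does not arrow [K_{k+1}] but each of its
   colourings without a monochromatic [K_{k+1}] contains the pattern up to a
   permutation of the colours, join a new vertex to every possible position of
   the pattern. The result arrows [K_{k+1}], so a Ramsey-minimal subgraph of it
   contains one of the new vertices, whose degree is at most [n].  Since every
   position gets a new vertex, the pattern need not appear at a prescribed place,
   and no signal senders are required.

   The first graph comes from the partite construction of Nesetril and Rodl: every
   [K_m]-free pattern [A] has a [K_m]-free pattern [B] such that each recolouring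
   of [B] contains a copy of [A] on which the new colour is a function [phi] of the
   old one. If [A] contains a two-coloured, non-monochromatic [K_m] for each pair
   of colours, then identifying two colours creates a monochromatic [K_m], so
   [phi] is a permutation unless the recolouring has a monochromatic [K_m]. *)

(** * Hales-Jewett and Ramsey theorems *)

(* Lines are words with [None] in the free positions. *)
Definition fill (T : Type) (L : seq (option T)) (e : T) : seq T := map (odflt e) L.

Lemma fill_cat (T : Type) (L M : seq (option T)) e :
  fill (L ++ M) e = fill L e ++ fill M e.
Proof. exact: map_cat. Qed.

Lemma fill_Some (T : Type) (w : seq T) e : fill (map Some w) e = w.
Proof. by rewrite /fill -map_comp; apply: map_id. Qed.

Lemma size_fill (T : Type) (L : seq (option T)) e : size (fill L e) = size L.
Proof. exact: size_map. Qed.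

(** Only letters of [s] are substituted, while fixed entries may be any letters of [T]; this permits
    induction on the alphabet. *)
Definition constant_line (T : finType) (C : Type) (N : nat) (c : seq T -> C)
    (s : seq T) (L : seq (option T)) (col : C) : Prop :=
  [/\ size L = N, None \in L & {in s, forall e, c (fill L e) = col}].

Definition hales_jewett_for (T : finType) (s : seq T) : Prop :=
  forall C : finType, exists N, forall c : seq T -> C,
    exists L col, constant_line N c s L col.

(* Colour focusing: the lines have distinct colours on [s] but share their point at [x]. *)
Lemma focused_lines (T : finType) (x e0 : T) (s : seq T) (C : finType) (l : nat) :
  e0 \in s -> hales_jewett_for s ->
  exists N, forall c : seq T -> C,
    (exists L col, constant_line N c (x :: s) L col) \/
    exists w (fs : seq (seq (option T) * C)),
      [/\ size w = N, size fs = l, uniq (map snd fs) &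
        {in fs, forall p, constant_line N c s p.1 p.2 /\ fill p.1 x = w}].
Proof.
move=> e0s HJs; elim: l => [|l [N HN]].
  by exists 0 => c; right; exists [::], [::]; split.
(* The first block is coloured by the whole colouring it induces on words of length [N], so along
   [L'] all letters of [s] act alike before every continuation. *)
have [N' HN'] := HJs {ffun N.-tuple T -> C}.
exists (N' + N) => c.
have [L' [col' [szL' starL' monoL']]] :=
  HN' (fun w => [ffun v : N.-tuple T => c (w ++ v)]).
have indep e v : e \in s -> size v = N ->
    c (fill L' e ++ v) = c (fill L' e0 ++ v).
  move=> es szv; have := monoL' e es; rewrite -(monoL' e0 e0s) => /ffunP.
  have szv' : size v == N by apply/eqP.
  by move=> /(_ (Tuple szv')); rewrite !ffunE.
have lift_line L col : constant_line N (fun v => c (fill L' e0 ++ v)) (x :: s) L col ->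
    constant_line (N' + N) c (x :: s) (map Some (fill L' e0) ++ L) col.
  case=> szL starL monoL; split.
  - by rewrite size_cat size_map size_fill szL' szL.
  - by rewrite mem_cat starL orbT.
  - by move=> e es; rewrite fill_cat fill_Some; apply: monoL.
have [[L [col HL]]|[w [fs [szw szfs uniqfs focus]]]] :=
  HN (fun v => c (fill L' e0 ++ v)).
  by left; exists (map Some (fill L' e0) ++ L), col; apply: lift_line.
(* If the focus has the colour of a focused line, that line extends to [x]. Otherwise its colour is
   new: a line varying only in the first block joins the old ones, which now vary in both blocks. *)
have [/mapP[p pfs colp]|new] :=
    boolP (c (fill L' e0 ++ w) \in map snd fs).
  left; exists (map Some (fill L' e0) ++ p.1), p.2; apply: lift_line.
  have [[szp starp monop] focp] := focus p pfs; split=> // e.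
  by rewrite inE => /predU1P[->|/monop //]; rewrite focp.
right; exists (fill L' x ++ w),
  ((L' ++ map Some w, c (fill L' e0 ++ w)) :: [seq (L' ++ p.1, p.2) | p <- fs]).
split.
- by rewrite size_cat size_fill szL' szw.
- by rewrite /= size_map szfs.
- by rewrite /= -map_comp (eq_map (g := snd)) ?new.
move=> p; rewrite inE => /predU1P[->|/mapP[q qfs ->]] /=.
  rewrite fill_cat fill_Some; split=> //; split.
  - by rewrite size_cat size_map szL' szw.
  - by rewrite mem_cat starL'.
  - by move=> e es; rewrite fill_cat fill_Some indep.
have [[szq starq monoq] focq] := focus q qfs.
rewrite fill_cat focq; split=> //; split.
- by rewrite size_cat szL' szq.
- by rewrite mem_cat starL'.
- by move=> e es; rewrite fill_cat indep ?size_fill // monoq.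
Qed.

(** More than [#|C|] focused lines cannot have distinct colours, so a line constant on [x :: s]
    appears. A one-letter alphabet is treated apart because focusing needs a letter [e0] in [s]. *)
Lemma hales_jewett_seq (T : finType) (s : seq T) : hales_jewett_for s.
Proof.
elim: s => [|x s IHs] C.
  by exists 1 => c; exists [:: None], (c [::]); split.
case: s IHs => [_|e0 s IHs].
  exists 1 => c; exists [:: None], (c [:: x]); split=> // e.
  by rewrite inE => /eqP->.
have [N HN] := @focused_lines _ x e0 _ C #|C|.+1 (mem_head e0 s) IHs.
exists N => c; have [//|[w [fs [_ szfs uniqfs _]]]] := HN c.
by have := max_card [in map snd fs]; rewrite (card_uniqP uniqfs) size_map szfs ltnn.
Qed.

Lemma hales_jewett (T C : finType) (col0 : C) :
  exists N, forall c : N.-tuple T -> C, exists (L : N.-tuple (option T)) (col : C),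
    None \in L /\ forall e, c (map_tuple (odflt e) L) = col.
Proof.
have [N HN] := @hales_jewett_seq T (enum T) C.
exists N => c.
(* The colouring of tuples is extended by [col0] to words of other lengths. *)
have [L [col [/eqP szL starL monoL]]] :=
  HN (fun w => odflt col0 (omap c (insub w))).
exists (Tuple szL), col; split=> // e.
rewrite -(monoL e (mem_enum _ _)); case: insubP => [w _ valw|] /=.
  by congr c; apply: val_inj; rewrite valw.
by rewrite size_fill szL.
Qed.

Lemma pigeonhole_seq (T : Type) (C : finType) (f : T -> C) (s : seq T) (m : nat) :
  #|C| * m < size s -> exists col, m < size [seq x <- s | f x == col].
Proof.
have sizeE : size s = \sum_col size [seq x <- s | f x == col].
  elim: s => [|x s IHs] /=; first by rewrite big1.
  rewrite [RHS](eq_bigr (fun col =>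
    (f x == col) + size [seq y <- s | f y == col])); last first.
    by move=> col _; case: eqP.
  rewrite big_split /= -IHs (bigD1 (f x)) //= eqxx big1 // => col.
  by rewrite eq_sym => /negPf->.
move=> ltms; apply/existsP; apply: contraLR ltms => /existsPn small.
rewrite -leqNgt sizeE -sum_nat_const; apply: leq_sum => col _.
by rewrite leqNgt small.
Qed.

(** First half of the proof of Ramsey's theorem: keep the head and a large colour class of the tail,
    so that the colour of a pair depends only on its earlier element. *)
Lemma end_homogeneous (C : finType) (l : nat) :
  exists R, forall (T : eqType) (psi : T -> T -> C) (s : seq T), R <= size s ->
    exists t : seq (T * C),
      [/\ size t = l, subseq (map fst t) s &
          pairwise (fun p q => psi p.1 q.1 == p.2) t].
Proof.
elim: l => [|l [R HR]].
  by exists 0 => T psi s _; exists [::]; rewrite sub0seq.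
exists (#|C| * R).+2 => T psi [//|x s] /= ltRs.
have [col ltR] := @pigeonhole_seq _ _ (psi x) _ _ ltRs.
have [t [szt subt homt]] := HR _ psi _ (ltnW ltR).
exists ((x, col) :: t); split=> /=; rewrite ?szt ?eqxx //.
  exact: subseq_trans subt (filter_subseq _ _).
rewrite homt andbT; apply/allP => p pt /=.
have /(mem_subseq subt) : p.1 \in map fst t by apply: map_f.
by rewrite mem_filter => /andP[].
Qed.

Lemma ramsey_pairs (V C : finType) :
  exists p, forall psi : 'I_p -> 'I_p -> C,
    exists (g : V -> 'I_p) (col : C), injective g /\
      forall u v, enum_rank u < enum_rank v -> psi (g u) (g v) = col.
Proof.
have [p Hp] : exists p, forall psi : 'I_p -> 'I_p -> C,
    exists t : seq ('I_p * C),
      [/\ size t = (#|C| * #|V|).+1, subseq (map fst t) (enum 'I_p) &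
          pairwise (fun p q => psi p.1 q.1 == p.2) t].
  have [p Hp] := end_homogeneous C (#|C| * #|V|).+1.
  by exists p => psi; apply: Hp; rewrite size_enum_ord.
exists p => psi; have [t [szt subt homt]] := Hp psi.
(* Among the elements with the same recorded colour, all pairs agree. *)
have [|col ltV] := @pigeonhole_seq _ C snd t #|V|.
  by rewrite szt.
pose s := take #|V| (map fst [seq x <- t | x.2 == col]).
have szs : size s == #|V| by rewrite size_takel ?size_map // ltnW.
have subs : subseq s (map fst t).
  apply: subseq_trans (take_subseq _ _) _.
  exact/map_subseq/filter_subseq.
have uniqs : uniq s.
  exact: subseq_uniq (subseq_trans subs subt) (enum_uniq _).
have homs : pairwise (fun x y => psi x y == col) s.
  apply: subseq_pairwise (take_subseq _ _) _; rewrite pairwise_map.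
  have: pairwise (fun p q => psi p.1 q.1 == p.2) [seq x <- t | x.2 == col].
    exact: subseq_pairwise (filter_subseq _ _) homt.
  apply: sub_in_pairwise (filter_all _ _) => x y /=.
  by move=> /eqP <- _.
exists (fun v => tnth (Tuple szs) (enum_rank v)), col; split.
  by move=> u v /(tuple_uniqP (Tuple szs) uniqs) /enum_rank_inj.
move=> u v ltuv; have x0 := tnth (Tuple szs) (enum_rank u).
rewrite !(tnth_nth x0) /=; apply/eqP.
by apply: (pairwiseP x0 homs); rewrite // inE (eqP szs).
Qed.

(** * The partite construction *)

Section Amalgam.
Context (V Q : finType) (r : nat) (part : V -> Q) (G : 'I_r -> rel V).
Context (a b : Q) (i : 'I_r) (N : nat).
Context (patG : colour_pattern G)
  (partG : forall j u v, G j u v -> part u != part v).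

(** The letters for Hales-Jewett: edges of colour [i], oriented from part [a] to part [b]. *)
Definition seam_edge : finType :=
  {e : V * V | [&& part e.1 == a, part e.2 == b & G i e.1 e.2]}.

Definition seam_end (e : seam_edge) (q : Q) : V :=
  if q == a then (val e).1 else (val e).2.

Definition amalgam : finType :=
  (Q * option (N.-tuple (option seam_edge)) * N.-tuple V)%type.

Definition amalgam_part (x : amalgam) : Q := x.1.1.

(* A copy of [V] for each line; copies share vertices only in the parts [a] and [b],
   where the last component records the vertex, with the free coordinates filled
   by the vertex itself. *)
Definition copy (L : N.-tuple (option seam_edge)) (u : V) : amalgam :=
  (part u, if part u \in [:: a; b] then None else Some L,
   map_tuple (fun o => if o is Some e then seam_end e (part u) else u) L).

Definition amalgam_rel (j : 'I_r) : rel amalgam := fun x y =>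
  [exists L : N.-tuple (option seam_edge), exists u, exists v,
     [&& None \in L, copy L u == x, copy L v == y & G j u v]].

Lemma amalgam_relP j x y :
  reflect (exists L u v, [/\ None \in L, copy L u = x, copy L v = y & G j u v])
          (amalgam_rel j x y).
Proof.
apply: (iffP existsP) => -[L].
  by case/existsP => u /existsP[v /and4P[starL /eqP Lu /eqP Lv Guv]]; exists L, u, v.
case=> u [v [starL Lu Lv Guv]]; exists L; apply/existsP; exists u.
by apply/existsP; exists v; rewrite starL Lu Lv Guv !eqxx.
Qed.

Lemma copy_tnth L u t : tnth (copy L u).2 t =
  if tnth L t is Some e then seam_end e (part u) else u.
Proof. by rewrite tnth_map. Qed.

Lemma copy_inj L : None \in L -> injective (copy L).
Proof.
case/tnthP => t Lt u v /(congr1 (fun x => tnth x.2 t)).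
by rewrite !copy_tnth -Lt.
Qed.

Lemma copy_off_seam L L' u u' :
  None \in L -> part u \notin [:: a; b] -> copy L u = copy L' u' ->
  L = L' /\ u = u'.
Proof.
move=> starL offu eqc; have [equ eqL _] := eqc.
have partu : part u' \notin [:: a; b] by rewrite -equ.
move: eqL; rewrite (negPf offu) (negPf partu) => -[eqL].
by split=> //; apply: (copy_inj starL); rewrite eqc eqL.
Qed.

Lemma pattern_sym j u v : G j u v = G j v u.
Proof. by have [sG _] := patG; have [-> _] := sG j. Qed.

Lemma pattern_colour_uniq j j' u v : G j u v -> G j' u v -> j = j'.
Proof.
move=> Gj Gj'; apply/eqP; apply/negPn/negP => neqj.
by have [_ /(_ _ _ _ _ neqj Gj)] := patG; rewrite Gj'.
Qed.

Lemma seam_end_rel e q q' :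
  q \in [:: a; b] -> q' \in [:: a; b] -> q != q' ->
  G i (seam_end e q) (seam_end e q').
Proof.
case: e => -[u v] edge_uv; rewrite !inE /seam_end /=.
have /and3P[/= _ _ Guv] := edge_uv.
have [-> _ _|_ /eqP ->] := eqVneq q a; first by rewrite eq_sym => /negPf->.
by have [_ _ _|_ /eqP ->] := eqVneq q' a; rewrite ?eqxx // pattern_sym.
Qed.

(* If both ends lie on the seam, compare a free coordinate of one line with
   the other line: a fixed entry there is an edge of colour [i]. *)
Lemma amalgam_induced j L u v :
  None \in L -> amalgam_rel j (copy L u) (copy L v) -> G j u v.
Proof.
move=> starL /amalgam_relP[L' [u' [v' [starL' eu ev Guv']]]].
have [pu pv] : part u' = part u /\ part v' = part v by case: eu; case: ev.
have [inu|offu] := boolP (part u \in [:: a; b]); last first.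
  have [eqL equ] := copy_off_seam starL offu (esym eu).
  by move: ev; rewrite -eqL => /(copy_inj starL) <-; rewrite equ.
have [inv|offv] := boolP (part v \in [:: a; b]); last first.
  have [eqL eqv] := copy_off_seam starL offv (esym ev).
  by move: eu; rewrite -eqL => /(copy_inj starL) <-; rewrite eqv.
have neq : part u != part v by rewrite -pu -pv; apply: partG Guv'.
have coord t : tnth (copy L' u').2 t = tnth (copy L u).2 t /\
               tnth (copy L' v').2 t = tnth (copy L v).2 t by rewrite eu ev.
have seam e : G i (seam_end e (part u)) (seam_end e (part v)).
  exact: seam_end_rel.
have [s L's] := tnthP _ _ starL'.
have [] := coord s; rewrite !copy_tnth -L's.
case: (tnth L s) => [e eu' ev'|<- <- //].
have eqij : i = j by apply: (@pattern_colour_uniq _ _ u' v') => //; rewrite eu' ev'.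
have [t Lt] := tnthP _ _ starL.
have [] := coord t; rewrite !copy_tnth -Lt pu pv.
by case: (tnth L' t) => [e' <- <-|<- <- //]; rewrite -eqij.
Qed.

Lemma amalgam_pattern : colour_pattern amalgam_rel.
Proof.
split=> [j|j j' x y neqj /amalgam_relP[L [u [v [starL <- <- Guv]]]]].
  split=> [x y|x].
    by apply/idP/idP => /amalgam_relP[L [u [v [starL eu ev Guv]]]];
       apply/amalgam_relP; exists L, v, u; rewrite pattern_sym.
  apply/negbTE/negP => /amalgam_relP[L [u [v [starL <- ev Guv]]]].
  by have := partG Guv; have [<- _ _] := ev; rewrite eqxx.
apply/negP => /(amalgam_induced starL) Guv'.
by rewrite (pattern_colour_uniq Guv Guv') eqxx in neqj.
Qed.

Lemma amalgam_partite j x y :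
  amalgam_rel j x y -> amalgam_part x != amalgam_part y.
Proof. by case/amalgam_relP => L [u [v [_ <- <- /partG]]]. Qed.

(** Clique vertices lie in distinct parts, so one is outside [a] and [b] and belongs to a single
    copy. Its neighbours lie in that copy too, and copies are induced. *)
Lemma amalgam_Kfree m : 2 < m -> pattern_Kfree G m -> pattern_Kfree amalgam_rel m.
Proof.
move=> m_gt2 Gfree j [f [_ fK]].
have [s offs] : exists s, amalgam_part (f s) \notin [:: a; b].
  apply/existsP; apply: contraLR m_gt2 => /existsPn ins.
  rewrite -leqNgt -[m]card_ord; apply: leq_trans (card_size [:: a; b]).
  have pinj : injective (amalgam_part \o f).
    move=> t t' /= eqp; apply/eqP; apply/negPn/negP => neqt.
    by have := amalgam_partite (fK _ _ neqt); rewrite eqp eqxx.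
  rewrite -(card_codom pinj); apply/subset_leq_card/subsetP => q.
  by case/codomP => t ->; have := ins t; rewrite negbK.
have [L [u0 [starL u0s]]] : exists L u0, None \in L /\ copy L u0 = f s.
  have [t neqt] : exists t, s != t.
    have m0 : 0 < m by apply: ltn_trans m_gt2.
    have m1 : 1 < m by apply: ltn_trans m_gt2.
    by have [->|nes] := eqVneq s (Ordinal m0); [exists (Ordinal m1)|exists (Ordinal m0)].
  have /amalgam_relP[L [u [v [starL <- _ _]]]] := fK _ _ neqt.
  by exists L, u.
have /fin_all_exists[g gE] t : exists v, copy L v = f t.
  have [<-|neqt] := eqVneq s t; first by exists u0.
  have /amalgam_relP[L' [u [v [starL' us vt _]]]] := fK _ _ neqt.
  have offu : part u \notin [:: a; b] by move: offs; rewrite -us.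
  have [eqL _] : L' = L /\ u = u0.
    by apply: copy_off_seam starL' offu _; rewrite us u0s.
  by exists v; rewrite -eqL.
have gK t t' : t != t' -> G j (g t) (g t').
  by move=> /fK; rewrite -!gE; apply: amalgam_induced.
apply: (Gfree j); exists g; split=> // t t' eqg.
apply/eqP; apply/negPn/negP => neqt.
by have := partG (gK _ _ neqt); rewrite eqg eqxx.
Qed.

End Amalgam.

Definition uniform_on (V W Q : finType) (r : nat) (part : V -> Q)
    (G : 'I_r -> rel V) (c : edge_colouring W r) (f : V -> W) (t : Q * Q * 'I_r) :=
  exists col, forall u v, part u = t.1.1 -> part v = t.1.2 -> G t.2 u v ->
    c [set f u; f v] = col.

Lemma partite_step (V Q : finType) (r m : nat) (part : V -> Q)
    (G : 'I_r -> rel V) (t : Q * Q * 'I_r) :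
  colour_pattern G -> (forall j u v, G j u v -> part u != part v) ->
  2 < m -> pattern_Kfree G m ->
  exists (W : finType) (partW : W -> Q) (B : 'I_r -> rel W),
    [/\ colour_pattern B, forall j u v, B j u v -> partW u != partW v,
        pattern_Kfree B m &
        forall c : edge_colouring W r, exists f : V -> W,
          [/\ injective f, forall u, partW (f u) = part u,
              forall j u v, G j u v -> B j (f u) (f v) &
              uniform_on part G c f t]].
Proof.
case: t => -[a b] i patG partG m_gt2 Gfree.
have [N HN] := @hales_jewett (seam_edge part G a b i) _ i.
exists (amalgam part G a b i N), (@amalgam_part _ _ _ _ _ _ _ _ _), (@amalgam_rel _ _ _ _ _ _ _ _ _).
split.
- exact: amalgam_pattern.
- by move=> j u v; apply: amalgam_partite.
- exact: amalgam_Kfree.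
move=> c.
(* A word of seam edges gets the colour of the pair formed by its sequences of first and second
   ends. Filling [L] with [e] gives the image of [e] under [copy L]. *)
have [L [col [starL monoL]]] := HN (fun w =>
  c [set (a, None, map_tuple (fun e => (val e).1) w);
         (b, None, map_tuple (fun e => (val e).2) w)]).
exists (copy L); split=> //.
- exact: copy_inj.
- by move=> j u v Guv; apply/amalgam_relP; exists L, u, v.
exists col => u v /= pu pv Guv.
have uvP : [&& part u == a, part v == b & G i u v] by rewrite pu pv !eqxx Guv.
pose e : seam_edge part G a b i := exist _ (u, v) uvP.
have neqab : b != a by rewrite -pu -pv eq_sym (partG i).
rewrite -(monoL e); congr (c [set _; _]);
  rewrite /copy ?pu ?pv !inE eqxx ?orbT; congr (_, _, _);
  apply: eq_from_tnth => s; rewrite !tnth_map; case: (tnth L s) => //= e';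
  by rewrite /seam_end ?eqxx ?(negPf neqab).
Qed.

(** Uniformity passes to part-preserving subcopies, so the triples can be treated one at a time. *)
Lemma partite_steps (V Q : finType) (r m : nat) (part : V -> Q)
    (G : 'I_r -> rel V) (s : seq (Q * Q * 'I_r)) :
  colour_pattern G -> (forall j u v, G j u v -> part u != part v) ->
  2 < m -> pattern_Kfree G m ->
  exists (W : finType) (partW : W -> Q) (B : 'I_r -> rel W),
    [/\ colour_pattern B, forall j u v, B j u v -> partW u != partW v,
        pattern_Kfree B m &
        forall c : edge_colouring W r, exists f : V -> W,
          [/\ injective f, forall u, partW (f u) = part u,
              forall j u v, G j u v -> B j (f u) (f v) &
              {in s, forall t, uniform_on part G c f t}]].
Proof.
move=> patG partG m_gt2 Gfree; elim: s V part G patG partG Gfree.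
  move=> V part G patG partG Gfree; exists V, part, G; split=> // c.
  by exists id; split.
move=> t s IHs V part G patG partG Gfree.
have [W [partW [B [patB partB Bfree HB]]]] := partite_step t patG partG m_gt2 Gfree.
have [X [partX [D [patD partD Dfree HD]]]] := IHs _ _ _ patB partB Bfree.
exists X, partX, D; split=> // c.
have [g [ginj gpart gG gs]] := HD c.
have [f [finj fpart fG [col colt]]] := HB (fun A => c (g @: A)).
exists (g \o f); split=> [||j u v /fG /gG //|t'].
- exact: inj_comp.
- by move=> u; rewrite /= gpart.
rewrite inE => /predU1P[->|/gs[col' colt']].
  exists col => u v pu pv Guv; rewrite -(colt u v) //.
  by rewrite imsetU !imset_set1.
by exists col' => u v pu pv Guv; apply: colt'; rewrite ?fpart //; apply: fG.
Qed.

(** The partite construction makes the new colour depend only on the two parts and the old colour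
    [j]. Ramsey's theorem, with functions of [j] as colours of pairs of parts, removes the
    dependence on the parts. *)
Theorem edge_partition_property (A : finType) (r m : nat) (G : 'I_r -> rel A) :
  colour_pattern G -> 2 < m -> pattern_Kfree G m ->
  exists (W : finType) (B : 'I_r -> rel W),
    [/\ colour_pattern B, pattern_Kfree B m &
        forall c : edge_colouring W r, exists (f : A -> W) (phi : 'I_r -> 'I_r),
          [/\ injective f, forall j u v, G j u v -> B j (f u) (f v) &
              forall j u v, G j u v -> c [set f u; f v] = phi j]].
Proof.
move=> patG m_gt2 Gfree; have [simG disjG] := patG.
have [p Hp] := ramsey_pairs A {ffun 'I_r -> 'I_r}.
(* A disjoint copy of [A] for each placement of its vertices in distinct parts. *)
pose V : finType := ({ffun A -> 'I_p} * A)%type.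
pose part (x : V) := x.1 x.2.
pose G0 j : rel V := fun x y => [&& x.1 == y.1, injectiveb x.1 & G j x.2 y.2].
have patG0 : colour_pattern G0.
  split=> [j|j j' x y neqj /and3P[_ _ Gxy]].
    have [symG irrG] := simG j; split=> [x y|x]; last by rewrite /G0 irrG !andbF.
    by rewrite /G0 symG eq_sym; case: eqP => // ->.
  by rewrite /G0 (negPf (disjG _ _ _ _ neqj Gxy)) !andbF.
have partG0 j x y : G0 j x y -> part x != part y.
  case/and3P => /eqP eqg /injectiveP xinj Gxy; rewrite /part -eqg.
  apply/eqP => /xinj eqx; have [_ irrG] := simG j.
  by rewrite eqx irrG in Gxy.
have G0free : pattern_Kfree G0 m.
  move=> j [f [_ fK]]; apply: (Gfree j); exists (snd \o f).
  have fK' s t : s != t -> G j (f s).2 (f t).2 by move/fK/and3P => [].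
  split=> // s t /= eqf; apply/eqP; apply/negPn/negP => /fK'.
  by rewrite eqf; have [_ ->] := simG j.
have [W [partW [B [patB _ Bfree HB]]]] :=
  partite_steps (enum {: 'I_p * 'I_p * 'I_r}) patG0 partG0 m_gt2 G0free.
exists W, B; split=> // c; have [f [finj _ fG0 unif]] := HB c.
have /fin_all_exists[psi psiP] (t : 'I_p * 'I_p * 'I_r) : uniform_on part G0 c f t.
  by apply: unif; rewrite mem_enum.
have [g [phi [ginj gphi]]] := Hp (fun x y => [ffun j => psi (x, y, j)]).
have gG j u v : G j u v -> G0 j ([ffun x => g x], u) ([ffun x => g x], v).
  rewrite /G0 /= eqxx => -> ; rewrite andbT.
  by apply/injectiveP => x y; rewrite !ffunE => /ginj.
exists (fun u => f ([ffun x => g x], u)), phi; split.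
- by move=> u v /finj[].
- by move=> j u v /gG /fG0.
(* Ramsey's theorem controls only pairs increasing in [enum_rank]; other edges are reversed. *)
move=> j u v; wlog ltuv : u v / enum_rank u < enum_rank v => [hwlog Guv|Guv].
  have [ltuv|ltvu|/val_inj/enum_rank_inj equv] :=
    ltngtP (enum_rank u) (enum_rank v).
  - exact: hwlog.
  - by rewrite setUC hwlog //; have [-> _] := simG j.
  - by rewrite equv in Guv; have [_ irr] := simG j; rewrite irr in Guv.
rewrite -(gphi _ _ ltuv) ffunE; apply: psiP; rewrite /part ?ffunE //=.
exact: gG.
Qed.

(** * Ramsey-minimal graphs of small minimum degree *)

Lemma arrows_sub (V W : finType) (S : {set V}) (E : rel V) (r : nat) (EH : rel W) :
  arrows S E r EH ->
  arrows [set: {x | x \in S}] (relpre val E) r EH.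
Proof.
move=> arrE c; have [f [finj [fS [i fi]]]] := arrE (fun A => c (val @^-1: A)).
exists (fun w => exist _ (f w) (fS w)); split; [|split=> [w|]].
- by move=> u v [/finj].
- exact: in_setT.
exists i => u v /fi[Euv <-]; split=> //; congr (c _).
by apply/setP => x; rewrite !inE -!val_eqE.
Qed.

(** Descent on the number of vertices plus ordered adjacent pairs; a smaller arrowing subgraph is
    moved to a vertex type of its own. *)
Lemma ramsey_minimal_subgraph (V W : finType) (E : rel V) (r : nat) (EH : rel W) :
  simple_graph E -> arrows setT E r EH ->
  exists (X : finType) (F : rel X) (f : X -> V),
    [/\ simple_graph F, ramsey_minimal F r EH, injective f &
        forall x y, F x y -> E (f x) (f y)].
Proof.
pose edges (T : finType) (R : rel T) := [set p : T * T | R p.1 p.2].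
have [l] := ubnP (#|V| + #|edges V E|).
elim: l V E => // l IHl V E ltl simE arrE; have [symE irrE] := simE.
have [[S [E' [[symE' [subE' lessE]] arrE']]]|minE] := classic (exists S E',
    proper_subgraph E S E' /\ arrows S E' r EH); last first.
  exists V, E, id; split=> //; split=> // S E' subE' arrE'.
  by apply: minE; exists S, E'.
have sub_edges : edges V E' \subset edges V E.
  by apply/subsetP => p; rewrite !inE => /subE'[].
have le_sub : #|edges _ (relpre (val : {x | x \in S} -> V) E')| <= #|edges V E'|.
  have vinj : injective (fun p : {x | x \in S} * {x | x \in S} => (val p.1, val p.2)).
    by move=> [x y] [x' y'] [/val_inj -> /val_inj ->].
  rewrite -(card_imset _ vinj); apply/subset_leq_card/subsetP => p.
  by case/imsetP => q; rewrite !inE => Eq ->.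
have [||X [F [f [simF minF finj fE]]]] :=
    IHl {x | x \in S} (relpre val E') _ _ (arrows_sub arrE').
- rewrite -ltnS; apply: leq_trans ltl; rewrite ltnS card_sig.
  have [leS leE] := (max_card S, subset_leq_card sub_edges).
  case: lessE => [neqS|[x [y [Exy nE'xy]]]].
    have ltS : #|S| < #|V| by rewrite -cardsT; apply: proper_card; rewrite properT.
    exact: leq_add ltS (leq_trans le_sub leE).
  apply: leq_ltn_trans (leq_add leS le_sub) _; rewrite ltn_add2l.
  apply: proper_card; rewrite properE sub_edges; apply/subsetPn.
  by exists (x, y); rewrite !inE.
- split=> x *; first exact: symE'.
  by apply/negbTE/negP => /subE'[]; rewrite irrE.
exists X, F, (val \o f); split=> //; first exact: inj_comp val_inj finj.
by move=> x y /fE /subE'[].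
Qed.

Definition union_rel (V : finType) (r : nat) (G : 'I_r -> rel V) : rel V :=
  fun x y => [exists j, G j x y].

Lemma union_rel_simple (V : finType) (r : nat) (G : 'I_r -> rel V) :
  colour_pattern G -> simple_graph (union_rel G).
Proof.
case=> simG _; split=> [x y|x].
  by apply: eq_existsb => j; have [-> _] := simG j.
by apply/negbTE/existsPn => j; have [_ ->] := simG j.
Qed.

Lemma pattern_colouring (V : finType) (r : nat) (G : 'I_r -> rel V) :
  0 < r -> colour_pattern G ->
  exists c : edge_colouring V r, forall j x y, G j x y -> c [set x; y] = j.
Proof.
move=> r_gt0 [simG disjG].
(* Disjointness of the pattern determines the colour of an edge; non-edges get colour 0. *)
exists (fun A => odflt (Ordinal r_gt0)
  [pick j | [exists x, exists y, (A == [set x; y]) && G j x y]]) => j x y Gxy.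
case: pickP => [j' /existsP[x' /existsP[y' /andP[/eqP eqA Gx'y']]]|/(_ j)] /=;
  last by move/existsP; case; exists x; apply/existsP; exists y; rewrite eqxx.
apply/eqP; apply: contraTT Gxy => neqj; apply: disjG neqj _.
have neq : x' != y' by apply: contraTneq Gx'y' => ->; have [_ ->] := simG j'.
have : x' \in [set x; y] by rewrite eqA !inE eqxx.
have : y' \in [set x; y] by rewrite eqA !inE eqxx orbT.
rewrite !inE => /pred2P[] ey /pred2P[] ex; rewrite ex ey ?eqxx // in neq Gx'y' *.
by have [-> _] := simG j'.
Qed.

(** Colour each edge by its pattern colour. This excludes Ramsey-minimal subgraphs without
    apices. *)
Lemma pattern_Kfree_not_arrows (V X : finType) (r m : nat) (G : 'I_r -> rel V)
    (F : rel X) (f : X -> V) :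
  0 < r -> colour_pattern G -> pattern_Kfree G m -> injective f ->
  (forall x y, F x y -> union_rel G (f x) (f y)) ->
  ~ arrows setT F r (@complete_rel m).
Proof.
move=> r_gt0 patG Gfree finj fF arrF.
have [c cG] := pattern_colouring r_gt0 patG.
have [g [ginj [_ [i gi]]]] := arrF (fun A => c (f @: A)).
apply: (Gfree i); exists (f \o g); split=> [|s t neqst]; first exact: inj_comp.
have [/fF/existsP[j Gj]] := gi s t neqst.
by rewrite imsetU !imset_set1 (cG _ _ _ Gj) => <-.
Qed.

(** * A pattern that detects the identification of two colours *)

Section MixedPattern.
Context (V : finType) (r m : nat) (G : 'I_r -> rel V).

Definition mixed_vertex : finType := (V + 'I_r * 'I_r * 'I_m)%type.

(* [G] together with, for all colours [i1 != i2], a copy of [K_m] in which the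
   edge {0, 1} has colour [i1] and every other edge has colour [i2]. *)
Definition mixed_rel (j : 'I_r) : rel mixed_vertex := fun x y =>
  match x, y with
  | inl u, inl v => G j u v
  | inr p, inr q => [&& p.1 == q.1, p.1.1 != p.1.2, p.2 != q.2 &
                        j == if p.2 + q.2 == 1 then p.1.1 else p.1.2]
  | _, _ => false
  end.

Lemma mixed_pattern : colour_pattern G -> colour_pattern mixed_rel.
Proof.
case=> simG disjG; split=> [j|j j' [u|p] [v|q] //= neqj].
- have [symG irrG] := simG j; split=> [[u|p] [v|q] //=|[u|p] //=]; last first.
    by rewrite !eqxx /= andbF.
  rewrite addnC [p.1 == _]eq_sym [p.2 == _]eq_sym.
  by case: eqP => // ->.
- exact: disjG.
- case/and4P => -> -> -> /eqP <- /=.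
  by rewrite eq_sym.
Qed.

(** A clique lies in [G] or in one mixed copy. In the latter case it fills the copy, where {0, 1}
    and {0, 2} differ in colour. *)
Lemma mixed_Kfree : 2 < m -> pattern_Kfree G m -> pattern_Kfree mixed_rel m.
Proof.
move=> m_gt2 Gfree j [f [finj fK]].
have m_gt0 : 0 < m by apply: ltn_trans m_gt2.
have m_gt1 : 1 < m by apply: ltn_trans m_gt2.
pose o0 := Ordinal m_gt0; pose o1 := Ordinal m_gt1; pose o2 := Ordinal m_gt2.
case f0 : (f o0) => [u|p].
  have /fin_all_exists[g gE] s : exists v, f s = inl v.
    have [<-|/fK] := eqVneq o0 s; first by exists u.
    by rewrite f0; case: (f s) => // v _; exists v.
  apply: (Gfree j); exists g; split=> [s t eqg|s t /fK].
    by apply: finj; rewrite !gE eqg.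
  by rewrite !gE.
have /fin_all_exists[g gE] s : exists t, f s = inr (p.1, t).
  have [<-|/fK] := eqVneq o0 s; first by rewrite f0; case: (p) => q t; exists t.
  by rewrite f0; case: (f s) => [//|[q t]] /= /and4P[/eqP -> _ _ _]; exists t.
have ginj : injective g by move=> s t eqg; apply: finj; rewrite !gE eqg.
have ontog t : exists s, g s = t.
  by have /codomP[s ->] := injF_onto ginj t; exists s.
have colour (s t : 'I_m) : s != t -> j = if s + t == 1 then p.1.1 else p.1.2.
  have [[s' <-] [t' <-]] := (ontog s, ontog t).
  rewrite (inj_eq ginj) => /fK; rewrite !gE /=.
  by case/and4P => _ _ _ /eqP.
have : p.1.1 != p.1.2.
  by have /fK : o0 != o1 by []; rewrite !gE /= => /and4P[].
have /= <- := colour o0 o1 isT; have /= <- := colour o0 o2 isT.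
by rewrite eqxx.
Qed.

End MixedPattern.

(** * Adding apices *)

Section Apices.
Context (V : finType) (n : nat) (E : rel V).

(** One apex for each map from the pattern's vertices to [V], joined to the image of that map. *)
Definition apex_vertex : finType := (V + {ffun 'I_n -> V})%type.

Definition apex_rel : rel apex_vertex := fun x y =>
  match x, y with
  | inl u, inl v => E u v
  | inl u, inr h => u \in codom h
  | inr h, inl u => u \in codom h
  | inr _, inr _ => false
  end.

Lemma apex_simple : simple_graph E -> simple_graph apex_rel.
Proof. by case=> symE irrE; split=> [[u|h] [v|h']|[u|h]] //=. Qed.

(** Apices are pairwise nonadjacent, so all neighbours are among the at most [n] values of [h]. *)
Lemma apex_degree (X : finType) (F : rel X) (f : X -> apex_vertex) x h :
  injective f -> (forall y z, F y z -> apex_rel (f y) (f z)) -> f x = inr h ->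
  degree F x <= n.
Proof.
move=> finj fF fx; rewrite /degree -(card_imset _ finj).
rewrite -[n in _ <= n]card_ord.
apply: leq_trans (leq_imset_card (fun t => inl (h t) : apex_vertex) _).
apply/subset_leq_card/subsetP => _ /imsetP[y Fxy ->].
move: Fxy; rewrite inE => /fF; rewrite fx.
by case: (f y) => //= u /codomP[t ->]; apply: imset_f.
Qed.

End Apices.

Lemma min_degree_le (V : finType) (E : rel V) (x : V) : min_degree E <= degree E x.
Proof.
rewrite /min_degree; have := mem_index_enum x.
elim: (index_enum V) => // y s IHs; rewrite inE big_cons geq_min.
by case/predU1P => [->|/IHs->]; rewrite ?leqnn ?orbT.
Qed.

Lemma apex_arrows (V : finType) (r k n : nat) (P : 'I_r -> rel 'I_n) (B : 'I_r -> rel V) :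
  (forall c : 'I_n -> 'I_r, strongly_mono_clique P c k) ->
  (forall c : edge_colouring V r,
    exists (f : mixed_vertex 'I_n r k.+1 -> V) (phi : 'I_r -> 'I_r),
      [/\ injective f, forall j u v, mixed_rel P j u v -> B j (f u) (f v) &
          forall j u v, mixed_rel P j u v -> c [set f u; f v] = phi j]) ->
  arrows setT (apex_rel (n := n) (union_rel B)) r (@complete_rel k.+1).
Proof.
move=> monoP HB c.
have [f [phi [finj fB cphi]]] := HB (fun A => c (inl @: A)).
have cphi' j u v : mixed_rel P j u v ->
    c [set inl (f u); inl (f v)] = phi j.
  by move=> /cphi <-; rewrite imsetU !imset_set1.
have edgef j u v : mixed_rel P j u v ->
    apex_rel (n := n) (union_rel B) (inl (f u)) (inl (f v)).
  by move=> /fB Bj; apply/existsP; exists j.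
(* If [phi] identifies [i1] and [i2], the mixed copy for them becomes monochromatic. *)
have [phi_inj|/injectivePn[i1 [i2 neqi eqphi]]] := altP (injectiveP phi); last first.
  exists (fun s => inl (f (inr (i1, i2, s)))); split; [|split=> //].
    by move=> s t [/finj[]].
  exists (phi i1) => s t neqst.
  pose j := if s + t == 1 then i1 else i2.
  have Pj : mixed_rel P j (inr (i1, i2, s)) (inr (i1, i2, t)).
    by rewrite /= eqxx neqi eqxx andbT.
  split; first exact: edgef Pj.
  by rewrite (cphi' _ _ _ Pj) /j; case: ifP.
(* The apex over the copy of [P] colours its vertices through the inverse of [phi]; a strongly
   monochromatic clique together with the apex is the required copy. *)
pose h := [ffun x => f (inl x)] : {ffun 'I_n -> V}.
have [i [g [ginj [gi gP]]]] :=
  monoP (fun x => invF phi_inj (c [set inl (h x); inr h])).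
have apexg a : c [set inl (h (g a)); inr h] = phi i by rewrite -(gi a) f_invF.
pose F (s : 'I_k.+1) : apex_vertex V n :=
  if unlift ord0 s is Some a then inl (h (g a)) else inr h.
have F0 : F ord0 = inr h by rewrite /F unlift_none.
have FS a : F (lift ord0 a) = inl (h (g a)) by rewrite /F liftK.
exists F; split; [|split=> //].
  move=> s t; case: (unliftP ord0 s) => [a|] ->; case: (unliftP ord0 t) => [b|] ->;
    rewrite ?F0 ?FS //.
  by rewrite !ffunE => -[/finj[/ginj ->]].
exists (phi i) => s t.
case: (unliftP ord0 s) => [a|] ->; case: (unliftP ord0 t) => [b|] ->;
  rewrite ?F0 ?FS /complete_rel ?eqxx //.
- rewrite (inj_eq lift_inj) !ffunE => /gP Pab.
  by split; [apply: (edgef i)|apply: cphi'].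
- by move=> _; split; [apply: codom_f|].
- by move=> _; rewrite setUC; split; [apply: codom_f|].
Qed.

(* s_r(K_{k+1}) <= P_r(k): for every n admissible in the definition of P_r(k)
   (in particular n = P_r(k)), some r-Ramsey-minimal graph for K_{k+1} has
   minimum degree at most n. *)
Theorem theorem2p3 (r k : nat) (hr : 2 <= r) (hk : 2 <= k) (n : nat) :
  P_witness r k n ->
  exists (V : finType) (E : rel V),
    simple_graph E /\ ramsey_minimal E r (@complete_rel k.+1) /\ min_degree E <= n.
Proof.
case=> P [patP [Pfree monoP]].
have m_gt2 : 2 < k.+1 by [].
have [W [B [patB Bfree HB]]] := edge_partition_property
  (mixed_pattern k.+1 patP) m_gt2 (mixed_Kfree m_gt2 Pfree).
have simE := apex_simple n (union_rel_simple patB).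
have [X [F [f [simF minF finj fF]]]] :=
  ramsey_minimal_subgraph simE (apex_arrows monoP HB).
exists X, F; split=> //; split=> //.
(* Either [F] contains an apex, of degree at most [n], or [F] embeds in the base graph, which does
   not arrow. *)
have [/existsP[x]|/existsPn base] := boolP [exists x, if f x is inr _ then true else false].
  case fx : (f x) => [//|h] _.
  exact: leq_trans (min_degree_le F x) (apex_degree finj fF fx).
have /fin_all_exists[g gE] x : exists w, f x = inl w.
  by move: (base x); case: (f x) => // w _; exists w.
have ginj : injective g by move=> x y eqg; apply: finj; rewrite !gE eqg.
have [arrF _] := minF.
case: (pattern_Kfree_not_arrows (ltnW hr) patB Bfree ginj _ arrF) => x y /fF.
by rewrite !gE.
Qed.
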